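(* Let $(\sigma_n)_{n\in\mathbb{N}}$, with $\sigma_n:\mathcal{A}_{n+1}^*\to\mathcal{A}_n^*$, be a sequence of substitutions which is everywhere growing, and let $X$ be the associated $S$-adic shift. Let $M_n$ be the incidence matrix of $\sigma_n$, and let $d_n$ be the cardinality of $\mathcal{A}_n$. Then the limit cone $$\lim_{n\to\infty} M_0M_1\cdots M_n\,\mathbb{R}_+^{d_{n+1}}=\bigcap_{n\ge 0} M_0M_1\cdots M_n\,\mathbb{R}_+^{d_{n+1}}$$ is the convex hull of the set of half-lines $\mathbb{R}_+f$ generated by the letter frequency vectors $f$ of words in $X$ (those words of $X$ that have a letter frequency vector).
   Context: All alphabets $\mathcal{A}_n$ are finite and non-empty; $\mathcal{A}_n^*$ is the free monoid of finite words over $\mathcal{A}_n$. A substitution is a morphism of free monoids $\sigma:\mathcal{A}^*\to\mathcal{B}^*$; all substitutions are assumed non-erasing (no letter is mapped to the empty word). For a word $w$, $|w|$ is its length and $|w|_i$ the number of occurrences of the letter $i$ in $w$. The incidence matrix of $\sigma:\mathcal{A}^*\to\mathcal{B}^*$ is the $\operatorname{Card}\mathcal{B}\times\operatorname{Card}\mathcal{A}$ matrix with entries $m_{i,j}=|\sigma(j)|_i$. Write $\sigma_{[0,n)}=\sigma_0\sigma_1\cdots\sigma_{n-1}:\mathcal{A}_n^*\to\mathcal{A}_0^*$. The sequence $(\sigma_n)_n$ is everywhere growing if for every sequence of letters $(a_n)_n$ with $a_n\in\mathcal{A}_n$ one has $\lim_{n\to\infty}|\sigma_{[0,n)}(a_n)|=+\infty$.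 The associated language is $L=\bigcap_{n\in\mathbb{N}}\overline{\sigma_{[0,n)}(\mathcal{A}_n)}$, where $\overline{M}$ denotes the factorial closure of a set of words $M$ (the set of all factors, i.e. words of consecutive letters, of elements of $M$). The associated $S$-adic shift $X\subset\mathcal{A}_0^{\mathbb{N}}$ is the set of infinite words all of whose factors belong to $L$. The frequency of a letter $i$ in an infinite word $u=u_0u_1\cdots$ is $\lim_{n\to\infty}|u_0\cdots u_{n-1}|_i/n$, if it exists; the letter frequency vector of $u$ is the vector of frequencies of all the letters of $\mathcal{A}_0$, when they all exist. $\mathbb{R}_+=[0,\infty)$.
   Formalization: The language L is taken as the intersection of the factorial closures of σ_[0,n)(A_n^* ), images of all words, instead of σ_[0,n)(A_n), images of letters: with letters only, the term n=0 has no word of length 2, so X would be empty and the claim false. *)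

(* Defs.v *)
From HB Require Import structures.
From mathcomp Require Import all_boot all_order all_algebra.
From mathcomp Require Import all_classical all_reals all_analysis.

Set Implicit Arguments.
Unset Strict Implicit.
Unset Printing Implicit Defensive.

Import Order.TTheory GRing.Theory Num.Theory.
Import numFieldNormedType.Exports.

Local Open Scope classical_set_scope.
Local Open Scope ring_scope.

Record substitution (A B : finType) := Substitution {
  subst_fun :> seq A -> seq B;
  subst_nil : subst_fun [::] = [::];
  subst_cat : {morph subst_fun : v w / v ++ w};
  subst_nonerasing : forall a : A, subst_fun [:: a] <> [::] }.

(* The matrix is indexed by 'I_#|B| and 'I_#|A|: letters are numbered by
   [enum_val]. *)
Definition incidence_mx (R : realType) (A B : finType)
    (s : substitution A B) : 'M[R]_(#|B|, #|A|) :=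
  \matrix_(i, j) (count_mem (enum_val i) (s [:: enum_val j]))%:R.

Section DirectiveSequence.
Variables (A : nat -> finType) (sigma : forall n, substitution (A n.+1) (A n)).

(* sigma_[0,n) = sigma_0 o ... o sigma_(n-1); the identity for n = 0. *)
Fixpoint subst_prefix (n : nat) : seq (A n) -> seq (A 0%N) :=
  match n with
  | 0%N => id
  | m.+1 => fun w => subst_prefix (sigma m w)
  end.

Definition everywhere_growing : Prop :=
  forall a : (forall n, A n),
    (fun n => size (subst_prefix [:: a n])) @ \oo --> \oo.

(* The factorial closure is taken of sigma_[0,n)(A_n^* ), the images of all
   words.  With the images of single letters every term of the intersection
   would be finite (for n = 0 it would contain no word of length 2), so no
   infinite word could have all its factors in the language. *)
Definition factorial_closure (T : eqType) (M : set (seq T)) : set (seq T) :=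
  [set w | exists2 v, M v & infix w v].

Definition language : set (seq (A 0%N)) :=
  \bigcap_n factorial_closure (range (@subst_prefix n)).

Definition Sadic_shift : set (nat -> A 0%N) :=
  [set u | forall k n, language [seq u i | i <- iota k n]].

(* M_0 M_1 ... M_n, with both endpoints included. *)
Fixpoint incidence_prod (R : realType) (n : nat) : 'M[R]_(#|A 0%N|, #|A n.+1|) :=
  match n with
  | 0%N => incidence_mx R (sigma 0%N)
  | m.+1 => incidence_prod R m *m incidence_mx R (sigma m.+1)
  end.

End DirectiveSequence.

Definition orthant (R : realType) (d : nat) : set 'cV[R]_d :=
  [set x | forall i, 0 <= x i 0].

Definition cone_seq (R : realType) (A : nat -> finType)
    (sigma : forall n, substitution (A n.+1) (A n)) (n : nat) :
    set 'cV[R]_#|A 0%N| :=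
  [set incidence_prod sigma R n *m x | x in @orthant R #|A n.+1|].

(* Set-theoretic convergence: the lower and upper limits of F are both C. *)
Definition set_lim (T : Type) (F : nat -> set T) (C : set T) : Prop :=
  \bigcup_n \bigcap_(k in [set k | (n <= k)%N]) F k = C /\ lim_sup_set F = C.

Definition letter_frequency (R : realType) (B : finType) (u : nat -> B) (b : B)
    (l : R) : Prop :=
  (fun n => (count_mem b (mkseq u n))%:R / n%:R : R) @ \oo --> l.

Definition frequency_vector (R : realType) (B : finType) (u : nat -> B)
    (f : 'cV[R]_#|B|) : Prop :=
  forall i, letter_frequency u (enum_val i) (f i 0).

Definition half_line (R : realType) (d : nat) (f : 'cV[R]_d) : set 'cV[R]_d :=
  [set t *: f | t in [set t : R | 0 <= t]].

Definition convex_hull (R : realType) (d : nat) (S : set 'cV[R]_d) :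
    set 'cV[R]_d :=
  smallest (fun C : set 'cV[R]_d => @convex_set R 'cV[R]_d C) S.

(* Main.v *)
Require Import Defs.
From HB Require Import structures.
From mathcomp Require Import all_boot all_order all_algebra.
From mathcomp Require Import all_classical all_reals all_analysis.
From mathcomp Require Import ring lra.

Set Implicit Arguments.
Unset Strict Implicit.
Unset Printing Implicit Defensive.

Import Order.TTheory GRing.Theory Num.Theory.
Import numFieldNormedType.Exports.

Local Open Scope classical_set_scope.
Local Open Scope ring_scope.

(** Write [C] for the intersection of the cones [M_0 ... M_n R_+^d]; the cones
decrease, so [C] is also their set-theoretic limit.

A frequency vector lies in [C]: for every n, a long prefix of a word of X is,
up to two pieces of bounded length, the image under sigma_[0,n] of a word. Its
normalised vector of letter counts is therefore asymptotically in the n-th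
cone, which is closed ([frequency_in_lcone]). As [C] is a convex cone, it
contains the convex hull.

For the converse, let [K] be the section of [C] by the simplex of vectors of
coordinate sum 1. A compact convex set of a finite dimensional space lies in
every convex set that contains its extreme points ([sub_convex_extreme]), so it
is enough to see that each extreme point f of [K] is the frequency vector of a
word of X ([extreme_frequency]). This is a finitary version of the fact that f,
being extreme, is the letter distribution of an ergodic measure. Since f is in
[C], for every n some word w = sigma_[0,n](v) has its frequencies as close to f
as desired. Fix a linear functional h with h.f < 0 and cut w into the images of
letters under sigma_[0,m]. If many of these blocks start a run of blocks on
which the sum of h is nonnegative, then such runs, taken disjoint, split w in
two parts: the first, y, has positive proportion and nonnegative h-sum
([maximal_inequality]). Both parts have count vectors in the m-th cone, and
their sum is nearly proportional to f. By compactness and extremality, y is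
then nearly proportional to f when m is large, whereas h is negative at f: a
contradiction ([extreme_thin]). So for most positions of w, every subsequent
partial sum of h stays below a constant that does not depend on w.

Doing this for a sequence of functionals h_s, with proportions of bad positions
summing to at most 1/2, leaves a position that is good for the first n of them
([extreme_words]). The words of length n read from these positions accumulate at
an infinite word u of X, along whose prefixes every h_s has bounded sums. If the
h_s run over +-(e_i - f_i) - 1/q, where e_i counts the letter i, this says that
u has frequency vector f. *)

(** * Limits along ultrafilters, coordinate by coordinate *)

Lemma fmap_ultra (S T : Type) (g : S -> T) (U : set_system S) :
  UltraFilter U -> UltraFilter (fmap g U).
Proof.
move=> UU; split=> [|G GF sUG]; first exact: fmap_proper_filter.
rewrite predeqE => P; split=> [GP|]; last exact: sUG.
have [//|/(sUG (~` P)) GnP] := in_ultra_setVsetC (g @^-1` P) UU.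
by have [x []] := filter_ex (filterI GP GnP).
Qed.

(** Ultrafilters replace the extraction of subsequences: along a fixed ultrafilter
    every bounded sequence converges, so that finitely many sequences are
    handled at once. *)
Lemma ultra_cvg_segment (R : realType) (U : set_system nat) (a b : R)
    (x : nat -> R) :
  UltraFilter U -> (\forall j \near U, a <= x j <= b) ->
  exists2 l, a <= l <= b & x @ U --> l.
Proof.
move=> UU xab; have := @segment_compact R a b; rewrite compact_ultra.
move=> /(_ (x @ U) (fmap_ultra x UU)) [|l [lab xl]].
  by apply: filterS xab => j; rewrite /= in_itv.
by exists l => //; move: lab; rewrite /= in_itv.
Qed.

Section EntrywiseLimits.
Variables (R : realType) (d : nat).
Implicit Types (x y z : 'cV[R]_d) (X Y : nat -> 'cV[R]_d) (h : 'I_d -> R).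

Definition entry_cvg (U : set_system nat) X x : Prop :=
  forall i, (fun j => X j i 0) @ U --> x i 0.

Definition limit_closed (C : set 'cV[R]_d) : Prop :=
  forall U X x, UltraFilter U -> (\forall j \near U, C (X j)) ->
    entry_cvg U X x -> C x.

Lemma ultra_entry_cvg U (a b : R) X : UltraFilter U ->
  (\forall j \near U, forall i, a <= X j i 0 <= b) ->
  exists2 x : 'cV[R]_d, (forall i, a <= x i 0 <= b) & entry_cvg U X x.
Proof.
move=> UU Xab.
have /choice[l lP] : forall i, exists l,
    (a <= l <= b) /\ (fun j => X j i 0) @ U --> l.
  move=> i; have [|l ? ?] := @ultra_cvg_segment R U a b (fun j => X j i 0) UU.
    by apply: filterS Xab => j; exact.
  by exists l.
by exists (\col_i l i) => i; rewrite mxE; have [] := lP i.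
Qed.

Definition dot h x : R := \sum_i h i * x i 0.

Lemma dotD h x y : dot h (x + y) = dot h x + dot h y.
Proof.
by rewrite /dot -big_split; apply: eq_bigr => i _; rewrite mxE mulrDr.
Qed.

Lemma dotZ h t x : dot h (t *: x) = t * dot h x.
Proof. by rewrite /dot mulr_sumr; apply: eq_bigr => i _; rewrite mxE mulrCA. Qed.

Lemma dot_cvg U h X x : UltraFilter U -> entry_cvg U X x ->
  (fun j => dot h (X j)) @ U --> dot h x.
Proof.
move=> UU Xx; apply: cvg_big => [|i _]; first exact: add_continuous.
by apply: cvgM; [exact: cvg_cst|exact: Xx].
Qed.

Lemma entry_cvgD U X Y x y : UltraFilter U ->
  entry_cvg U X x -> entry_cvg U Y y ->
  entry_cvg U (fun j => X j + Y j) (x + y).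
Proof.
move=> UU Xx Yy i; rewrite mxE; under eq_fun do rewrite mxE.
by apply: cvgD; [exact: Xx|exact: Yy].
Qed.

Lemma entry_cvg_unique U X x y : UltraFilter U ->
  entry_cvg U X x -> entry_cvg U X y -> x = y.
Proof.
move=> UU Xx Xy; apply/colP => i.
by apply: cvg_unique (Xx i) (Xy i); exact: norm_hausdorff.
Qed.

End EntrywiseLimits.
(** On the orthant this is the l1 norm; on a vector of letter counts it is the
    length of the word. *)
Notation mass := (dot (fun=> 1)).

Section OrthantMass.
Variables (R : realType) (d : nat).
Implicit Types x : 'cV[R]_d.

Lemma massE x : mass x = \sum_i x i 0.
Proof. by apply: eq_bigr => i _; rewrite mul1r. Qed.

Lemma mass_ge0 x : orthant x -> 0 <= mass x.
Proof. by move=> x0; rewrite massE sumr_ge0. Qed.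

Lemma entry_le_mass x i : orthant x -> x i 0 <= mass x.
Proof.
by move=> x0; rewrite massE (bigD1 i)//= lerDl sumr_ge0.
Qed.

Lemma mass_eq0 x : orthant x -> mass x = 0 -> x = 0.
Proof.
move=> x0 tx; apply/colP => i; rewrite mxE; apply/eqP; rewrite eq_le x0 andbT.
by rewrite -tx; exact: entry_le_mass.
Qed.

End OrthantMass.

(** * Compact convex sets are spanned by their extreme points *)

(** Take a subspace of maximal dimension inside the set: a vector outside of it
    could be added to it. *)
Lemma linear_set_vspace (K : fieldType) (V : vectType K) (P : set V) :
  P 0 -> (forall a x y, P x -> P y -> P (a *: x + y)) ->
  exists W : {vspace V}, forall v, v \in W <-> P v.
Proof.
move=> P0 Plin.
pose dimP k := `[< exists W : {vspace V},
  (forall v, v \in W -> P v) /\ \dim W = k >].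
have exP : exists k, dimP k.
  exists 0%N; apply/asboolP; exists 0%VS; rewrite dimv0; split=> // v.
  by rewrite memv0 => /eqP ->.
have leP k : dimP k -> (k <= \dim {:V})%N.
  by move=> /asboolP[W [_ <-]]; exact: dimvS (subvf W).
have [k /asboolP[W [WP dimW]] maxk] := ex_maxnP exP leP.
exists W => v; split=> [|Pv]; first exact: WP.
have /maxk : dimP (\dim (W + <[v]>)).
  apply/asboolP; exists (W + <[v]>)%VS; split=> // w.
  move=> /memv_addP[x xW [y /vlineP[a ->] ->]]; rewrite addrC.
  by apply: Plin => //; exact: WP.
rewrite -dimW => le_dim; have /eqP -> : W == (W + <[v]>)%VS.
  by rewrite eqEdim addvSl.
by apply: (subvP (addvSr _ _)); exact: memv_line.
Qed.

Section Minkowski.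
Variables (R : realType) (d : nat).
Implicit Types (x y v w f : 'cV[R]_d) (K D : set 'cV[R]_d).

Lemma convex_setP D : @convex_set R 'cV[R]_d D <->
  forall x y (t : R), 0 <= t <= 1 -> D x -> D y -> D (t *: x + (1 - t) *: y).
Proof.
split=> [cD x y t t01 Dx Dy|cD x y t /[!inE] Dx Dy].
  have [t0 t1] := andP t01; pose p : {i01 R} := Itv01 t0 t1.
  by have := cD x y p (mem_set Dx) (mem_set Dy); rewrite inE.
by apply: cD => //; apply/andP; split.
Qed.

(** In terms of midpoints, which is equivalent to the usual definition when K is
    convex. *)
Definition extreme_point K f : Prop :=
  K f /\ forall v, K (f + v) -> K (f - v) -> v = 0.

(** The directions of the smallest face of K that contains x in its relative
    interior. *)
Definition face_direction K x v : Prop :=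
  exists2 e : R, 0 < e & K (x + e *: v) /\ K (x - e *: v).

Variables (K : set 'cV[R]_d) (B : R).
Hypothesis cK : @convex_set R 'cV[R]_d K.
Hypothesis closedK : limit_closed K.
Hypothesis boundK : forall x, K x -> forall i, `|x i 0| <= B.

Lemma convex_segment x v (e t : R) : K x -> K (x + e *: v) -> 0 <= t <= e ->
  K (x + t *: v).
Proof.
move=> Kx Kxe /andP[t0 te]; have [e0|e0] := eqVneq e 0.
  by have -> : t = e by apply/eqP; rewrite eq_le te e0.
have e_gt0 : 0 < e by rewrite lt_neqAle eq_sym e0 (le_trans t0).
have -> : x + t *: v = (t / e) *: (x + e *: v) + (1 - t / e) *: x.
  by apply/colP => i; rewrite !mxE; field.
move/convex_setP : cK; apply => //.
by rewrite divr_ge0 ?(ltW e_gt0)//= ler_pdivrMr// mul1r.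
Qed.

Lemma face_direction_vspace x : K x ->
  exists W : {vspace 'cV[R]_d}, forall v, v \in W <-> face_direction K x v.
Proof.
move=> Kx; apply: linear_set_vspace.
  by exists 1 => //; rewrite scaler0 addr0 subr0.
have scl a v : face_direction K x v -> face_direction K x (a *: v).
  have pos (b : R) w : 0 < b -> face_direction K x w -> face_direction K x (b *: w).
    move=> b0 [e e0 Kw]; exists (e / b); first exact: divr_gt0.
    by rewrite scalerA mulfVK ?gt_eqF.
  have opp w : face_direction K x w -> face_direction K x (- w).
    by move=> [e e0 [? ?]]; exists e => //; rewrite scalerN opprK.
  move=> Fv; have [a0|a0|->] := ltgtP a 0.
  - have -> : a *: v = (- a) *: (- v) by rewrite scalerN scaleNr opprK.
    by apply: pos; [rewrite oppr_gt0|exact: opp].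
  - exact: pos.
  - by exists 1 => //; rewrite scale0r scaler0 addr0 subr0.
move=> a y z /(scl a) [e e0 [Ky1 Ky2]] [g g0 [Kz1 Kz2]].
pose m := Num.min e g; have m0 : 0 < m by rewrite lt_min e0 g0.
have me : 0 <= m <= e by rewrite (ltW m0) ge_min lexx.
have mg : 0 <= m <= g by rewrite (ltW m0) ge_min lexx orbT.
have half : 0 <= (2^-1 : R) <= 1 by lra.
have mid p q : K p -> K q -> K (2^-1 *: p + (1 - 2^-1) *: q).
  by move=> Kp Kq; move/convex_setP : cK; exact.
rewrite -scalerN in Ky2; rewrite -scalerN in Kz2.
exists (m / 2); first by rewrite divr_gt0.
split.
- have -> : x + (m / 2) *: (a *: y + z) =
      2^-1 *: (x + m *: (a *: y)) + (1 - 2^-1) *: (x + m *: z).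
    by apply/colP => i; rewrite !mxE; field.
  by apply: mid; [exact: convex_segment Ky1 me|exact: convex_segment Kz1 mg].
- have -> : x - (m / 2) *: (a *: y + z) =
      2^-1 *: (x + m *: - (a *: y)) + (1 - 2^-1) *: (x + m *: - z).
    by apply/colP => i; rewrite !mxE; field.
  by apply: mid; [exact: convex_segment Ky2 me|exact: convex_segment Kz2 mg].
Qed.

Lemma exit_point x v : K x -> v != 0 ->
  exists t : R, [/\ 0 <= t, K (x + t *: v) &
    forall e, 0 < e -> ~ K (x + (t + e) *: v)].
Proof.
move=> Kx v0; pose T : set R := [set t | 0 <= t /\ K (x + t *: v)].
have [i vi] : exists i, v i 0 != 0.
  apply/existsP; rewrite -negb_forall; apply: contra v0 => /forallP v0.
  by apply/eqP/colP => i; rewrite mxE; exact/eqP.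
have T0 : T 0 by split=> //; rewrite scale0r addr0.
have ubT : ubound T ((B + `|x i 0|) / `|v i 0|).
  move=> t [t0 /boundK /(_ i)]; rewrite !mxE => le_B.
  rewrite ler_pdivlMr ?normr_gt0// -(ger0_norm t0) -normrM.
  have := ler_normB (x i 0 + t * v i 0) (x i 0).
  rewrite (addrC (x i 0)) addrK; rewrite addrC in le_B; lra.
have hubT : has_ubound T by eexists; exact: ubT.
have supT : has_sup T by split=> //; exists 0.
have maxT t : T t -> t <= sup T by exact: (ub_le_sup hubT).
have t0 := maxT _ T0.
exists (sup T); split=> //; last first.
  move=> e e0 Ke; suff : sup T + e <= sup T by lra.
  by apply: maxT; split=> //; lra.
have /choice[s sP] : forall n : nat, exists s, T s /\ sup T - n.+1%:R^-1 < s.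
  move=> n; have [|s Ts ?] := @sup_adherent _ T n.+1%:R^-1 _ supT => //.
  by exists s.
have scvg : s @ \oo --> sup T.
  apply: (@squeeze_cvgr _ _ _ _ (fun n => sup T - n.+1%:R^-1) (fun=> sup T)).
  - apply: nearW => n; have [Ts /ltW ->] := sP n; exact: maxT.
  - rewrite -[X in _ --> X]subr0; apply: cvgB; first exact: cvg_cst.
    exact: cvg_harmonic.
  - exact: cvg_cst.
have [U [UU sU]] := ultraFilterLemma (@eventually_filter : ProperFilter \oo).
apply: (closedK (U := U) (X := fun n => x + s n *: v)).
  by apply: nearW => n; have [[]] := sP n.
move=> j; rewrite !mxE; under eq_fun do rewrite !mxE.
apply: cvgD; first exact: cvg_cst.
apply: cvgM; last exact: cvg_cst.
by move=> P /scvg; exact: sU.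
Qed.

(** Induction on the dimension of the face of x. If x is not extreme, follow a line
    of the face in both directions up to the boundary of K: x is between the
    two exit points, whose faces have lost at least the direction of the line. *)
Lemma sub_convex_extreme D : @convex_set R 'cV[R]_d D ->
  extreme_point K `<=` D -> K `<=` D.
Proof.
move=> cD extD.
suff ind n : forall x (W : {vspace 'cV[R]_d}), K x ->
    (forall v, v \in W <-> face_direction K x v) -> (\dim W < n)%N -> D x.
  move=> x Kx; have [W WP] := face_direction_vspace Kx.
  exact: (ind (\dim W).+1) Kx WP _.
elim: n => // n IH x W Kx WP dimW.
have [[v [Fv v0]]|noF] := pselect (exists v, face_direction K x v /\ v != 0);
    last first.
  apply: extD; split=> // v Kp Km; apply: contrapT => /eqP v0; apply: noF.
  by exists v; split=> //; exists 1; rewrite ?scale1r.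
(* Every direction w of the face of the exit point is one of the face of x: x is
   in the open segment from the exit point to another point of K, and the
   homothety centred at the latter carries the segment along w to one at x. *)
have side u (t t' : R) : u != 0 -> face_direction K x u -> 0 < t -> 0 < t' ->
    K (x + t *: u) -> K (x - t' *: u) ->
    (forall e, 0 < e -> ~ K (x + (t + e) *: u)) -> D (x + t *: u).
  move=> u0 Fu t0 t'0 Kt Kt' maxt.
  have [W' W'P] := face_direction_vspace Kt.
  apply: (IH _ W' Kt W'P); rewrite ltnS in dimW; apply: leq_trans dimW.
  have sW : (W' <= W)%VS.
    apply/subvP => w /W'P [e e0 [Kp Km]]; apply/WP.
    pose a := t' / (t + t').
    have tt' : 0 < t + t' by exact: addr_gt0.
    have ne : t + t' != 0 by rewrite gt_eqF.
    have a01 : 0 <= a <= 1.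
      by rewrite divr_ge0 ?(ltW t'0) ?(ltW tt')//= ler_pdivrMr//; lra.
    exists (a * e); first by rewrite mulr_gt0// divr_gt0// addr_gt0.
    split.
    - have -> : x + (a * e) *: w =
          a *: (x + t *: u + e *: w) + (1 - a) *: (x - t' *: u).
        by apply/colP => i; rewrite !mxE /a; field.
      by move/convex_setP : cK; exact.
    - have -> : x - (a * e) *: w =
          a *: (x + t *: u - e *: w) + (1 - a) *: (x - t' *: u).
        by apply/colP => i; rewrite !mxE /a; field.
      by move/convex_setP : cK; exact.
  rewrite ltn_neqAle dimvS// andbT (dimv_leqif_eq sW).
  apply/eqP => WW'; have : u \in W' by rewrite WW'; exact/WP.
  by move=> /W'P [e e0 [Ke _]]; apply: (maxt e e0); rewrite scalerDl addrA.
have Nv0 : - v != 0 by rewrite oppr_eq0.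
have Fv' : face_direction K x (- v).
  by case: Fv => e e0 [? ?]; exists e => //; rewrite scalerN opprK.
have pos u : u != 0 -> face_direction K x u -> exists t : R, [/\ 0 < t,
    K (x + t *: u) & forall e, 0 < e -> ~ K (x + (t + e) *: u)].
  move=> u0 [e e0 [Ke _]]; have [t [t0 Kt maxt]] := exit_point Kx u0.
  exists t; split=> //; rewrite lt_neqAle t0 andbT; apply/eqP => t0'.
  by apply: (maxt e e0); rewrite -t0' add0r.
have [t [t0 Kt maxt]] := pos _ v0 Fv.
have [s [s0 Ks maxs]] := pos _ Nv0 Fv'.
have Dt : D (x + t *: v).
  by apply: side t0 s0 Kt _ maxt => //; rewrite -scalerN.
have Ds : D (x + s *: - v).
  by apply: side s0 t0 Ks _ maxs => //; rewrite scalerN opprK.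
have st : 0 < s + t by exact: addr_gt0.
have ne : s + t != 0 by rewrite gt_eqF.
have -> : x = (s / (s + t)) *: (x + t *: v) + (1 - s / (s + t)) *: (x + s *: - v).
  by apply/colP => i; rewrite !mxE; field.
move/convex_setP : cD; apply => //.
by rewrite divr_ge0 ?(ltW s0) ?(ltW st)//= ler_pdivrMr//; lra.
Qed.

End Minkowski.

(** * Vectors of letter counts and the cone of a substitution *)

Section ImageCone.
Variable R : realType.

Definition abel (B : finType) (w : seq B) : 'cV[R]_#|B| :=
  \col_i (count_mem (enum_val i) w)%:R.

Lemma abel_cat (B : finType) (v w : seq B) : abel (v ++ w) = abel v + abel w.
Proof. by apply/colP => i; rewrite !mxE count_cat natrD. Qed.

Lemma abel_perm (B : finType) (v w : seq B) : perm_eq v w -> abel v = abel w.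
Proof. by move=> /permP vw; apply/colP => i; rewrite !mxE vw. Qed.

Lemma abel_orthant (B : finType) (w : seq B) : orthant (abel w).
Proof. by move=> i; rewrite mxE. Qed.

Lemma dot_abel (B : finType) (h : 'I_#|B| -> R) (w : seq B) :
  dot h (abel w) = \sum_(a <- w) h (enum_rank a).
Proof.
elim: w => [|a w IH].
  by rewrite big_nil /dot big1// => i _; rewrite mxE mulr0.
rewrite big_cons -IH -cat1s abel_cat dotD; congr +%R.
rewrite /dot (bigD1 (enum_rank a))//= mxE enum_rankK /= eqxx mulr1 big1 ?addr0//.
move=> i ia; rewrite mxE /= (_ : a == _ = false) ?mulr0//.
by apply: contraNF ia => /eqP ->; rewrite enum_valK.
Qed.

Lemma mass_abel (B : finType) (w : seq B) : mass (abel w) = (size w)%:R.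
Proof.
by rewrite dot_abel; elim: w => [|a w IH]; rewrite ?big_nil// big_cons IH nat1r.
Qed.

Lemma abel_subst (T B : finType) (s : substitution T B) (w : seq T) :
  abel (s w) = incidence_mx R s *m abel w.
Proof.
elim: w => [|a w IH].
  rewrite subst_nil; apply/colP => i; rewrite !mxE big1// => j _.
  by rewrite [X in _ * X]mxE mulr0.
rewrite -cat1s subst_cat !abel_cat IH mulmxDr; congr +%R.
apply/colP => i; rewrite !mxE (bigD1 (enum_rank a))//= !mxE enum_rankK /= eqxx.
rewrite mulr1 big1 ?addr0// => j ja; rewrite !mxE /= (_ : a == _ = false) ?mulr0//.
by apply: contraNF ja => /eqP ->; rewrite enum_valK.
Qed.

Lemma prescribed_abel (B : finType) (c : 'I_#|B| -> nat) :
  exists w : seq B, forall i, abel w i 0 = (c i)%:R.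
Proof.
exists (flatten [seq nseq (c j) (enum_val j) | j <- index_enum 'I_#|B|]) => i.
rewrite mxE count_flatten sumnE !big_map.
rewrite (bigD1 i)//= count_nseq /= eqxx mul1n.
rewrite big1 ?addn0// => j ji; rewrite count_nseq /= (inj_eq enum_val_inj).
by rewrite (negbTE ji) mul0n.
Qed.

Variables (T B : finType) (s : substitution T B).
Implicit Types (x y : 'cV[R]_#|B|).

Definition image_cone : set 'cV[R]_#|B| :=
  [set incidence_mx R s *m x | x in @orthant R #|T|].

(** The columns of the matrix have sum at least 1, as no letter is erased. *)
Lemma mass_incidence_ge (x : 'cV[R]_#|T|) :
  orthant x -> mass x <= mass (incidence_mx R s *m x).
Proof.
move=> x0; rewrite !massE; under [X in _ <= X]eq_bigr do rewrite mxE.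
rewrite exchange_big ler_sum// => j _; rewrite -mulr_suml.
rewrite -[X in X <= _]mul1r ler_wpM2r//.
have -> : \sum_i incidence_mx R s i j = mass (abel (s [:: enum_val j])).
  by rewrite massE; apply: eq_bigr => i _; rewrite !mxE.
rewrite mass_abel ler1n lt0n size_eq0.
by apply/eqP; exact: subst_nonerasing.
Qed.

Lemma image_cone_orthant : image_cone `<=` @orthant R #|B|.
Proof.
move=> _ [x x0 <-] i; rewrite mxE sumr_ge0// => j _.
by rewrite mxE mulr_ge0.
Qed.

Lemma image_coneD x y : image_cone x -> image_cone y -> image_cone (x + y).
Proof.
move=> [u u0 <-] [v v0 <-]; exists (u + v); last by rewrite mulmxDr.
by move=> i; rewrite mxE addr_ge0.
Qed.

Lemma image_coneZ t x : 0 <= t -> image_cone x -> image_cone (t *: x).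
Proof.
move=> t0 [u u0 <-]; exists (t *: u); last by rewrite scalemxAr.
by move=> i; rewrite mxE mulr_ge0.
Qed.

Lemma image_cone_word w : image_cone (abel (s w)).
Proof. by exists (abel w); [exact: abel_orthant|rewrite abel_subst]. Qed.

(** Preimages in the orthant of a convergent sequence stay bounded by
    [mass_incidence_ge], hence have a limit along the ultrafilter. *)
Lemma image_cone_closed : limit_closed image_cone.
Proof.
move=> U X x UU Xcone Xx.
have /choice[Z ZP] : forall j, exists z, image_cone (X j) ->
    orthant z /\ incidence_mx R s *m z = X j.
  move=> j; have [[z z0 zX]|nX] := pselect (image_cone (X j)); first by exists z.
  by exists 0.
have [|z z_ge0 Zz] := @ultra_entry_cvg R #|T| U 0 (mass x + 1) Z UU.
  have tX : \forall j \near U, mass (X j) < mass x + 1.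
    by apply: (cvgr_lt _ (dot_cvg UU Xx)); rewrite ltrDl.
  apply: filterS2 Xcone tX => j /ZP [Z0 ZX] /ltW le_tX i; rewrite Z0 /=.
  by apply: le_trans (entry_le_mass i Z0) (le_trans (mass_incidence_ge Z0) _); rewrite ZX.
exists z; first by move=> i; have /andP[] := z_ge0 i.
apply: (entry_cvg_unique UU) Xx => i.
have : (fun j => dot (incidence_mx R s i) (Z j)) @ U --> dot (incidence_mx R s i) z.
  exact: dot_cvg.
rewrite [(_ *m z) i 0]mxE; apply: cvg_trans; apply: near_eq_cvg.
by apply: filterS Xcone => j /ZP [_ <-]; rewrite mxE.
Qed.

(** Round down the coefficients of N x over the generators of the cone, and take a
    word with these letter counts; the error is at most the sum of the entries of the
    matrix. *)
Lemma image_cone_words x : image_cone x ->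
  exists2 c : R, 0 <= c & forall N : nat, exists v, forall i,
    `|abel (s v) i 0 - N%:R * x i 0| <= c.
Proof.
move=> [z z0 <-]; exists (\sum_i \sum_j incidence_mx R s i j) => [|N].
  by rewrite sumr_ge0// => i _; rewrite sumr_ge0// => j _; rewrite mxE.
have [v vP] := prescribed_abel (fun j => Num.truncn (N%:R * z j 0)).
exists v => i; rewrite abel_subst !mxE mulr_sumr -sumrB.
have M0 k j : 0 <= incidence_mx R s k j by rewrite mxE.
apply: (@le_trans _ _ (\sum_j incidence_mx R s i j)); last first.
  by rewrite [X in _ <= X](bigD1 i)//= lerDl sumr_ge0// => k _; rewrite sumr_ge0.
apply: le_trans (ler_norm_sum _ _ _) _; apply: ler_sum => j _.
rewrite vP mulrCA -mulrBr normrM ger0_norm//.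
rewrite -[X in _ <= X]mulr1 ler_wpM2l//.
have /truncn_itv /andP[t1 t2] : 0 <= N%:R * z j 0 by rewrite mulr_ge0.
rewrite -natr1 in t2; rewrite ler_norml; lra.
Qed.

End ImageCone.

(** * Blocks and the maximal inequality *)

Section Blocks.
Variables (T B : finType) (s : substitution T B).

Definition block_bound N := forall a, (size (s [:: a]) <= N)%N.

Lemma ex_block_bound : exists N, block_bound N.
Proof.
by exists (\max_a size (s [:: a])) => a; exact: (leq_bigmax (F := fun a => size _)).
Qed.

Lemma subst_cons a v : s (a :: v) = s [:: a] ++ s v.
Proof. exact: (subst_cat s [:: a]). Qed.

Lemma take_subst N v l : block_bound N ->
  exists k q, take l (s v) = s (take k v) ++ q /\ (size q <= N)%N.
Proof.
move=> sN; elim: v l => [|a v IH] l; first by exists 0%N, [::]; rewrite subst_nil.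
rewrite subst_cons take_cat; case: ltnP => la.
  exists 0%N, (take l (s [:: a])); rewrite take0 subst_nil; split=> //.
  by rewrite size_take la (leq_trans (ltnW la)).
have [k [q [-> qN]]] := IH (l - size (s [:: a]))%N.
by exists k.+1, q; rewrite /= (subst_cons a (take k v)) catA.
Qed.

Lemma drop_subst N v l : block_bound N ->
  exists k q, drop l (s v) = q ++ s (drop k v) /\ (size q <= N)%N.
Proof.
move=> sN; elim: v l => [|a v IH] l; first by exists 0%N, [::]; rewrite subst_nil.
rewrite subst_cons drop_cat; case: ltnP => la.
  exists 1%N, (drop l (s [:: a])); rewrite drop1; split=> //.
  by rewrite size_drop (leq_trans (leq_subr _ _)).
have [k [q [-> qN]]] := IH (l - size (s [:: a]))%N.
by exists k.+1, q.
Qed.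

(** A factor of an image is an image up to the two blocks in which it begins and
    ends. *)
Lemma infix_subst N x v : block_bound N -> infix x (s v) ->
  exists p v' q, [/\ x = p ++ s v' ++ q, (size p <= N)%N & (size q <= N)%N].
Proof.
move=> sN /infixP[p [q sv]].
have -> : x = take (size x) (drop (size p) (s v)).
  by rewrite sv drop_size_cat// take_size_cat.
have [k [p' [-> p'N]]] := drop_subst v (size p) sN.
rewrite take_cat; case: ltnP => xp'.
  exists (take (size x) p'), [::], [::]; rewrite subst_nil !cats0.
  by split=> //; rewrite size_take xp' (leq_trans (ltnW xp')).
have [l [q' [-> q'N]]] := take_subst (drop k v) (size x - size p') sN.
by exists p', (take l (drop k v)), q'.
Qed.

End Blocks.

Section Maximal.
Variables (R : realType) (T B : finType) (s : substitution T B) (h : B -> R).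

Definition overshoots (c : R) (x : seq B) : bool :=
  `[< exists l, c < \sum_(a <- take l x) h a >].

Definition overshoot_count (c : R) (w : seq B) : nat :=
  count (fun p => overshoots c (drop p w)) (iota 0 (size w)).

Lemma overshoot_count_cat c x y :
  overshoot_count c (x ++ y) =
  (count (fun p => overshoots c (drop p (x ++ y))) (iota 0 (size x)) +
   overshoot_count c y)%N.
Proof.
rewrite /overshoot_count size_cat iotaD count_cat add0n; congr addn.
rewrite -[X in iota X _](addn0 (size x)) iotaDl count_map.
by apply: eq_count => p; rewrite /= addnC -drop_drop drop_size_cat.
Qed.

Lemma norm_sum_le M N (x : seq B) : 0 <= M -> (forall a, `|h a| <= M) ->
  (size x <= N)%N -> `|\sum_(a <- x) h a| <= N%:R * M.
Proof.
move=> M0 hM xN; apply: (@le_trans _ _ ((size x)%:R * M)); last first.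
  by rewrite ler_wpM2r// ler_nat.
elim: x {xN} => [|a x IH]; first by rewrite big_nil normr0 mul0r.
rewrite big_cons /= -natr1 mulrDl mul1r addrC.
by apply: le_trans (ler_normD _ _) _; rewrite lerD.
Qed.

(** This is the maximal ergodic inequality for the sequence of blocks of [s v].
    Read v from left to right. If the sum of h over the blocks is nonnegative on
    some run starting at the current letter, put this run in y and resume after
    it; otherwise put the letter in z. In the second case the sums over all runs
    of blocks starting there are nonpositive; a sum that starts and stops inside
    blocks differs from such a sum by the contributions of two incomplete
    blocks, at most N M each. Hence no position of that block overshoots 2 N M,
    and all the overshooting positions are in [s y]. *)
Lemma maximal_inequality N M v : block_bound s N ->
  0 <= M -> (forall a, `|h a| <= M) ->
  exists y z, [/\ perm_eq v (y ++ z), 0 <= \sum_(a <- s y) h a &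
    (overshoot_count (2 * (N%:R * M)) (s v) <= size (s y))%N].
Proof.
move=> sN M0 hM; set c := 2 * _.
have [n] := ubnP (size v); elim: n v => // n IH v.
case: v => [|a v] sv.
  by exists [::], [::]; rewrite /= subst_nil big_nil.
rewrite /= ltnS in sv.
have [[k [k0 Hk]]|noH] :=
    pselect (exists k, (0 < k)%N /\ 0 <= \sum_(b <- s (take k (a :: v))) h b).
  have [|y [z [pyz y0 ny]]] := IH (drop k (a :: v)).
    case: k k0 {Hk} => // k _; rewrite size_drop subSS.
    exact: leq_ltn_trans (leq_subr _ _) sv.
  exists (take k (a :: v) ++ y), z; split.
  - by rewrite -{1}(cat_take_drop k (a :: v)) -catA perm_cat2l.
  - by rewrite subst_cat big_cat addr_ge0.
  - rewrite -{1}(cat_take_drop k (a :: v)) !subst_cat overshoot_count_cat.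
    by rewrite size_cat leq_add// (leq_trans (count_size _ _)) ?size_iota.
have [|y [z [pyz y0 ny]]] := IH v; first by [].
exists y, (a :: z); split=> //.
  by rewrite perm_sym -cat1s perm_catCA /= perm_cons perm_sym.
rewrite subst_cons overshoot_count_cat (_ : count _ _ = 0%N)//.
apply/eqP; rewrite -leqn0 leqNgt -has_count -all_predC; apply/allP => p.
rewrite mem_iota add0n /= => pa; apply/asboolP => -[l].
rewrite -subst_cons ltNge => /negP; apply.
have [k [q [Eq qN]]] := take_subst (a :: v) (p + l) sN.
have E : \sum_(b <- take p (s (a :: v))) h b +
    \sum_(b <- take l (drop p (s (a :: v)))) h b =
    \sum_(b <- s (take k (a :: v))) h b + \sum_(b <- q) h b.
  by rewrite -!big_cat -takeD Eq.
have Hk : \sum_(b <- s (take k (a :: v))) h b <= 0.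
  case: k {Eq E} => [|k]; first by rewrite take0 subst_nil big_nil.
  by rewrite leNgt; apply/negP => /ltW Hk; apply: noH; exists k.+1.
have := norm_sum_le M0 hM qN; rewrite ler_norml => /andP[_ Hq].
have pN : (size (take p (s (a :: v))) <= N)%N.
  by rewrite size_take_min (leq_trans (geq_minl _ _))// (leq_trans (ltnW pa)).
have := norm_sum_le M0 hM pN; rewrite ler_norml => /andP[Hp _].
rewrite /c; lra.
Qed.
End Maximal.

(** * The limit cone *)

Lemma near_div_le (R : realType) (c e : R) : 0 < e ->
  \forall k \near \oo, c / k%:R <= e.
Proof.
move=> e0; apply: filterS2 (nbhs_infty_gt 0) (nbhs_infty_ger (c / e)) => k k0.
by rewrite ler_pdivrMr// ler_pdivrMr ?ltr0n// mulrC.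
Qed.

Section LimitCone.
Variables (R : realType) (A : nat -> finType).
Variable sigma : forall n, substitution (A n.+1) (A n).

Lemma subst_prefix_cat n : {morph @subst_prefix A sigma n : v w / v ++ w}.
Proof. by elim: n => // n IH v w /=; rewrite subst_cat IH. Qed.

Lemma subst_prefix_nil n : @subst_prefix A sigma n [::] = [::].
Proof. by elim: n => // n IH /=; rewrite subst_nil. Qed.

Lemma subst_prefix_eq_nil n w : @subst_prefix A sigma n w = [::] -> w = [::].
Proof.
elim: n w => // n IH w /= /IH; case: w => // a w.
rewrite subst_cons => /(congr1 size)/eqP; rewrite size_cat addn_eq0 size_eq0.
by case/andP => /eqP /(subst_nonerasing (s := sigma n)).
Qed.

Lemma subst_prefix_nonerasing n (a : A n) :
  @subst_prefix A sigma n [:: a] <> [::].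
Proof. by move/subst_prefix_eq_nil. Qed.

(** Bundling the composite as a substitution lets the results on the cone of a
    single substitution apply to every cone of the sequence. *)
Definition prefix_substitution n : substitution (A n) (A 0%N) :=
  Substitution (@subst_prefix_nil n) (@subst_prefix_cat n)
    (@subst_prefix_nonerasing n).

Lemma incidence_prodE n :
  incidence_prod sigma R n = incidence_mx R (prefix_substitution n.+1).
Proof.
elim: n => [|n IH].
  by apply/matrixP => i j; rewrite !mxE.
apply/matrixP => i j /=; rewrite IH.
transitivity (abel R (prefix_substitution n.+1 (sigma n.+1 [:: enum_val j])) i 0).
  rewrite abel_subst !mxE; apply: eq_bigr => k _; congr (_ * _).
  by rewrite !mxE.
by rewrite !mxE.
Qed.

Notation cone := (@cone_seq R A sigma).
Notation lcone := (\bigcap_n @cone_seq R A sigma n).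

Lemma cone_seqE n : cone n = image_cone (prefix_substitution n.+1).
Proof. by rewrite /cone_seq incidence_prodE. Qed.

Lemma subst_prefix_range m n : (m <= n)%N ->
  range (@subst_prefix A sigma n) `<=` range (@subst_prefix A sigma m).
Proof.
elim: n => [|n IH]; first by rewrite leqn0 => /eqP ->.
rewrite leq_eqVlt => /predU1P[->//|]; rewrite ltnS => mn _ [w _ <-].
by apply: (IH mn); exists (sigma n w).
Qed.

Lemma cone_seq_subset m n : (m <= n)%N -> cone n `<=` cone m.
Proof.
move=> mn; elim: n mn => [|n IH]; first by rewrite leqn0 => /eqP ->.
rewrite leq_eqVlt => /predU1P[->//|]; rewrite ltnS => mn _ [x x0 <-].
apply: (IH mn); exists (incidence_mx R (sigma n.+1) *m x).
  move=> i; rewrite mxE sumr_ge0// => j _; rewrite mulr_ge0//.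
  by rewrite mxE.
by rewrite mulmxA.
Qed.

(** The j-th point is in all the cones of index at most j, and each cone is closed. *)
Lemma cone_seq_limit U (X : nat -> 'cV[R]_#|A 0%N|) (M : R) :
  UltraFilter U -> \oo `<=` U ->
  (forall j, cone j (X j)) -> (forall j, mass (X j) <= M) ->
  exists2 x, lcone x & entry_cvg U X x.
Proof.
move=> UU sU Xcone XM.
have X0 j : orthant (X j).
  by apply: (@image_cone_orthant _ _ _ (prefix_substitution j.+1)); rewrite -cone_seqE.
have [|x _ Xx] := @ultra_entry_cvg R #|A 0%N| U 0 M X UU.
  by apply: nearW => j i; rewrite X0 /=; exact: le_trans (entry_le_mass i (X0 j)) _.
exists x => // m _; rewrite cone_seqE.
apply: (image_cone_closed (U := U) (X := X)) Xx; rewrite -cone_seqE.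
by apply: sU; exists m => // j mj; exact: (cone_seq_subset mj).
Qed.

Lemma lconeD x y : lcone x -> lcone y -> lcone (x + y).
Proof.
move=> Cx Cy n _; rewrite cone_seqE.
by apply: image_coneD; rewrite -cone_seqE; [exact: Cx|exact: Cy].
Qed.

Lemma lconeZ t x : 0 <= t -> lcone x -> lcone (t *: x).
Proof.
move=> t0 Cx n _; rewrite cone_seqE.
by apply: image_coneZ; rewrite -?cone_seqE//; exact: Cx.
Qed.

Lemma lcone_orthant : lcone `<=` @orthant R #|A 0%N|.
Proof.
by move=> x /(_ 0%N I); rewrite cone_seqE; exact: image_cone_orthant.
Qed.

Lemma lcone_closed : limit_closed lcone.
Proof.
move=> U X x UU XC Xx n _; rewrite cone_seqE.
apply: (image_cone_closed (U := U) (X := X)) Xx.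
by apply: filterS XC => j /(_ n I); rewrite cone_seqE.
Qed.

(** By [infix_subst] a prefix of length k of u has, up to 2 N, the letter counts of
    an image under sigma_[0,n], where N bounds the length of the images of
    letters; after division by k the error vanishes and the cone is closed. *)
Lemma frequency_in_lcone u f : Sadic_shift sigma u -> frequency_vector u f ->
  lcone f.
Proof.
move=> uX uf n _; rewrite cone_seqE; set s := prefix_substitution n.+1.
have [N sN] := ex_block_bound s.
have /choice[v vP] : forall k, exists v, forall i,
    `|abel R (mkseq u k) i 0 - abel R (s v) i 0| <= (2 * N)%:R.
  move=> k; have [w [v _ <-] uw] := uX 0%N k n.+1 I.
  have [p [v' [q [Eu pN qN]]]] := infix_subst sN uw.
  exists v' => i; rewrite /mkseq Eu !abel_cat !mxE.
  set cp := (count _ p)%:R; set cq := (count _ q)%:R; set cv := (count _ _)%:R.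
  have -> : cp + (cv + cq) - cv = cp + cq by ring.
  rewrite -natrD normr_nat ler_nat mul2n -addnn leq_add//.
    exact: leq_trans (count_size _ _) pN.
  exact: leq_trans (count_size _ _) qN.
have [U [UU sU]] := ultraFilterLemma (@eventually_filter : ProperFilter \oo).
apply: (@image_cone_closed _ _ _ s U (fun k => k%:R^-1 *: abel R (s (v k)))) => //.
  by apply: nearW => k; apply: image_coneZ; [rewrite invr_ge0|exact: image_cone_word].
move=> i P Pf; apply: sU; move: P Pf.
suff : (fun k => (k%:R^-1 *: abel R (s (v k))) i 0) @ \oo --> f i 0 by [].
have -> : (fun k => (k%:R^-1 *: abel R (s (v k))) i 0) =
   (fun k => (count_mem (enum_val i) (mkseq u k))%:R / k%:R -
     (abel R (mkseq u k) i 0 - abel R (s (v k)) i 0) / k%:R).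
  apply/funext => k; rewrite [LHS]mxE [in RHS]mxE -mulrBl mulrC.
  by congr (_ / _); rewrite subKr.
rewrite -[X in _ --> X]subr0; apply: cvgB; first exact: uf.
apply/cvgr0Pnorm_le => e e0; apply: filterS (near_div_le (2 * N)%:R e0) => k.
apply: le_trans; rewrite normrM [`|_^-1|]ger0_norm ?invr_ge0//.
by rewrite ler_wpM2r ?invr_ge0.
Qed.

(** A compact base of the limit cone, whose extreme points span the extreme rays. *)
Definition lsimplex : set 'cV[R]_#|A 0%N| := [set x | lcone x /\ mass x = 1].

(** The images of single letters, normalised, accumulate at a point of the limit
    cone. *)
Lemma lsimplex_nonempty : (forall n, 0 < #|A n|)%N -> lsimplex !=set0.
Proof.
move=> A0; pose w j := @subst_prefix A sigma j.+1
  [:: enum_val (Ordinal (A0 j.+1))].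
have w0 j : ((size (w j))%:R != 0 :> R).
  rewrite pnatr_eq0 size_eq0; apply/eqP.
  exact: (subst_nonerasing (s := prefix_substitution j.+1)).
pose X j : 'cV[R]_#|A 0%N| := (size (w j))%:R^-1 *: abel R (w j).
have tX j : mass (X j) = 1 by rewrite dotZ mass_abel mulVf.
have [U [UU sU]] := ultraFilterLemma (@eventually_filter : ProperFilter \oo).
have [| |x Cx Xx] := @cone_seq_limit U X 1 UU sU.
- move=> j; rewrite cone_seqE; apply: image_coneZ; first by rewrite invr_ge0.
  exact: (image_cone_word R (prefix_substitution j.+1)).
- by move=> j; rewrite tX.
exists x; split=> //; apply: (cvg_unique _ (dot_cvg UU Xx)).
  exact: norm_hausdorff.
by apply: cvg_near_cst; exact: nearW.
Qed.

(** With a and b the coordinate sums of y and z, so that a + b = 1, the vector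
    v = y - a f equals b y - a z; hence f + v and f - v are nonnegative
    combinations of y and z, and extremality gives v = 0. *)
Lemma extreme_split f y z : extreme_point lsimplex f -> lcone y -> lcone z ->
  y + z = f -> y = mass y *: f.
Proof.
move=> [[Cf tf] ext] Cy Cz yz; apply/subr0_eq.
pose a := mass y; pose b := mass z; pose v := y - a *: f.
have ab : a + b = 1 by rewrite -tf -yz dotD.
have a0 : 0 <= a by exact: mass_ge0 (lcone_orthant Cy).
have b0 : 0 <= b by exact: mass_ge0 (lcone_orthant Cz).
have tv : mass v = 0.
  by rewrite /v -scaleN1r dotD !dotZ tf -/a; ring.
have bE : b = 1 - a by rewrite -ab; ring.
apply: ext; rewrite -/a -/v; split.
- have -> : f + v = (1 + b) *: y + b *: z.
    by rewrite /v bE -yz; apply/colP => i; rewrite !mxE; ring.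
  by apply: lconeD; apply: lconeZ => //; rewrite addr_ge0.
- by rewrite dotD tv tf addr0.
- have -> : f - v = a *: y + (1 + a) *: z.
    by rewrite /v -yz; apply/colP => i; rewrite !mxE; ring.
  by apply: lconeD; apply: lconeZ => //; rewrite addr_ge0.
- by rewrite -scaleN1r dotD dotZ tv tf mulr0 addr0.
Qed.

(** Otherwise take counterexamples for m going to infinity and delta = 1/(m+1). At
    the limit f = y + z with y and z in the limit cone, y of sum at least eta and
    h.y nonnegative; but y is a positive multiple of f by [extreme_split]. *)
Lemma extreme_thin f h (eta : R) : extreme_point lsimplex f -> dot h f < 0 ->
  0 < eta -> exists m delta, 0 < delta /\
  forall y z, cone m y -> cone m z ->
    (forall i, `|y i 0 + z i 0 - f i 0| <= delta) ->
    0 <= dot h y -> mass y <= eta.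
Proof.
move=> extf hf eta0; apply: contrapT => /forallNP noM.
have /choice[yz yzP] : forall m : nat, exists yz : 'cV[R]_#|A 0%N| * 'cV[R]_#|A 0%N|,
    [/\ cone m yz.1, cone m yz.2,
      (forall i, `|yz.1 i 0 + yz.2 i 0 - f i 0| <= m.+1%:R^-1),
      0 <= dot h yz.1 & eta < mass yz.1].
  move=> m; apply: contrapT => /forallNP noyz; apply: (noM m).
  exists m.+1%:R^-1; split=> [|y z Cy Cz yzf hy]; first by rewrite invr_gt0.
  by rewrite leNgt; apply/negP => ty; apply: (noyz (y, z)).
have [U [UU sU]] := ultraFilterLemma (@eventually_filter : ProperFilter \oo).
have Y0 j : orthant (yz j).1.
  have [+ _ _ _ _] := yzP j; rewrite cone_seqE; exact: image_cone_orthant.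
have Z0 j : orthant (yz j).2.
  have [_ + _ _ _] := yzP j; rewrite cone_seqE; exact: image_cone_orthant.
pose M := \sum_i (f i 0 + 1).
have tM j : mass (yz j).1 + mass (yz j).2 <= M.
  rewrite -dotD massE /M ler_sum// => i _; rewrite mxE.
  have [_ _ /(_ i) + _ _] := yzP j; rewrite ler_norml => /andP[_].
  have : (j.+1%:R^-1 : R) <= 1 by rewrite invf_le1 ?ler1n.
  by move: j.+1%:R^-1 => q q1 yzq; lra.
have [y Cy Yy] : exists2 y, lcone y & entry_cvg U (fun j => (yz j).1) y.
  apply: (@cone_seq_limit _ _ M UU sU) => j; first by have [] := yzP j.
  by apply: le_trans (tM j); rewrite lerDl mass_ge0.
have [z Cz Zz] : exists2 z, lcone z & entry_cvg U (fun j => (yz j).2) z.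
  apply: (@cone_seq_limit _ _ M UU sU) => j; first by have [] := yzP j.
  by apply: le_trans (tM j); rewrite lerDr mass_ge0.
have yzf : y + z = f.
  apply: (entry_cvg_unique UU (entry_cvgD UU Yy Zz)) => i.
  suff : (fun j => ((yz j).1 + (yz j).2) i 0) @ \oo --> f i 0.
    by move=> lim P /lim; exact: sU.
  apply/cvgrPdist_le => e e0.
  have := @near_infty_natSinv_lt R (PosNum e0).
  apply: filterS => j /= /ltW je; apply: le_trans je; rewrite distrC mxE.
  by have [_ _ + _ _] := yzP j.
have ty : eta <= mass y.
  apply: (closed_cvg (fun t : R => eta <= t) (@closed_ge R eta) _ _ (dot_cvg UU Yy)).
  by apply: nearW => j; have [_ _ _ _ /ltW] := yzP j.
have hy : 0 <= dot h y.
  have hY : \forall j \near U, 0 <= dot h (yz j).1.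
    by apply: nearW => j; have [] := yzP j.
  exact: (closed_cvg (fun t : R => 0 <= t) (@closed_ge R 0) hY _ (dot_cvg UU Yy)).
have := extreme_split extf Cy Cz yzf => yE.
rewrite yE dotZ in hy.
have : mass y * dot h f < 0 by rewrite nmulr_llt0//; exact: lt_le_trans ty.
by rewrite ltNge hy.
Qed.

End LimitCone.

(** * An infinite word for each extreme point *)

(** Koenig's lemma: among the prefixes shared by infinitely many x n, each can be
    extended by a letter. *)
Lemma prefix_limit (B : finType) (x : nat -> seq B) :
  (forall n, size (x n) = n) ->
  exists u : nat -> B, forall k N, exists2 n, (N <= n)%N & prefix (mkseq u k) (x n).
Proof.
move=> sx; pose persistent w := forall N, exists2 n, (N <= n)%N & prefix w (x n).
have step w : persistent w -> exists a, persistent (rcons w a).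
  move=> pw; apply: contrapT => /forallNP nP.
  have /choice[N NP] : forall a, exists N, forall n, (N <= n)%N ->
      ~~ prefix (rcons w a) (x n).
    move=> a; apply: contrapT => /forallNP nN; apply: (nP a) => N.
    apply: contrapT => nn; apply: (nN N) => n Nn; apply/negP => pn.
    by apply: nn; exists n.
  have [n nN /prefixP[[|a t] xn]] := pw (maxn (size w).+1 (\max_a N a)).
    have := sx n; rewrite xn cats0 => wn; move: nN.
    by rewrite -wn geq_max ltnn.
  have /negP := NP a n (leq_trans (leq_bigmax a) (leq_trans (leq_maxr _ _) nN)).
  by apply; rewrite xn -cat_rcons prefix_prefix.
have p0 : persistent [::] by move=> N; exists N => //; exact: prefix0s.
pose S := {w | persistent w}.
have /choice[g gP] : forall w : S, exists a, persistent (rcons (sval w) a).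
  by move=> [w pw]; exact: step.
pose W := fix W n : S := if n is m.+1 then exist _ _ (gP (W m)) else exist _ _ p0.
exists (fun n => g (W n)) => k; suff -> : mkseq (fun n => g (W n)) k = sval (W k).
  exact: (svalP (W k)).
by elim: k => //= k IH; rewrite mkseqS IH.
Qed.

Lemma exists_avoiding (I : eqType) (r : seq I) n (P : nat -> pred I) :
  (\sum_(s < n) count (P s) r < size r)%N ->
  exists2 p, p \in r & forall s, (s < n)%N -> ~~ P s p.
Proof.
elim: n r => [|n IH] r.
  rewrite big_ord0; case: r => // p r _; exists p => //; exact: mem_head.
rewrite big_ord_recr /= => lt_r.
have [|p] := IH [seq p <- r | ~~ P n p].
  rewrite size_filter -(ltn_add2r (count (P n) r)) [X in (_ < X)%N]addnC.
  rewrite count_predC; apply: leq_ltn_trans lt_r; rewrite leq_add2r.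
  apply: leq_sum => s _; rewrite count_filter; apply: sub_count => p /=.
  by case/andP.
rewrite mem_filter => /andP[/= nPp pr] Pp; exists p => // s.
by rewrite ltnS leq_eqVlt => /predU1P[->|/Pp].
Qed.

Section Construction.
Variables (R : realType) (A : nat -> finType).
Variable sigma : forall n, substitution (A n.+1) (A n).
Notation cone := (@cone_seq R A sigma).
Notation lcone := (\bigcap_n @cone_seq R A sigma n).

Lemma sum_half n : \sum_(s < n) 2^-1 ^+ s.+2 <= 2^-1 :> R.
Proof.
suff -> : \sum_(s < n) 2^-1 ^+ s.+2 = 2^-1 - 2^-1 ^+ n.+1 :> R.
  by rewrite gerBl exprn_ge0// invr_ge0.
elim: n => [|n IH]; first by rewrite big_ord0 expr1 subrr.
by rewrite big_ord_recr /= IH !exprS; field.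
Qed.

(** The two parts given by [maximal_inequality] have normalised count vectors in the
    m-th cone with sum close to f, so that [extreme_thin] bounds the part that
    contains the overshooting positions. *)
Lemma words_with_few_overshoots (f : 'cV[R]_#|A 0%N|) (h : 'I_#|A 0%N| -> R) (eta : R) :
  extreme_point (lsimplex sigma) f -> dot h f < 0 -> 0 < eta ->
  exists m delta c, 0 < delta /\ forall w (N : nat),
    range (@subst_prefix A sigma m.+1) w -> (0 < N)%N ->
    (forall i, `|abel R w i 0 - N%:R * f i 0| <= delta * N%:R) ->
    (overshoot_count (fun a => h (enum_rank a)) c w)%:R <= eta * N%:R.
Proof.
move=> extf hf eta0; have [m [delta [delta0 thin]]] := extreme_thin extf hf eta0.
pose s := prefix_substitution sigma m.+1; have [K sK] := ex_block_bound s.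
pose M := \sum_i `|h i|; have M0 : 0 <= M by exact: sumr_ge0.
have hM a : `|h (enum_rank a)| <= M.
  by rewrite /M (bigD1 (enum_rank a))//= lerDl sumr_ge0.
exists m, delta, (2 * (K%:R * M)); split=> // _ N [v _ <-] N0 wf.
have [y [z [vyz y0 ny]]] := maximal_inequality v sK M0 hM.
have NR : 0 < N%:R :> R by rewrite ltr0n.
have Ew : abel R (s v) = abel R (s y) + abel R (s z).
  by rewrite abel_subst (abel_perm R vyz) abel_cat mulmxDr -!abel_subst.
have Cs t : cone m (N%:R^-1 *: abel R (s t)).
  rewrite cone_seqE; apply: image_coneZ; first by rewrite invr_ge0.
  exact: image_cone_word.
have := thin _ _ (Cs y) (Cs z).
rewrite !dotZ dot_abel mass_abel mulr_ge0 ?invr_ge0// => /(_ _ isT) le_eta.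
apply: (@le_trans _ _ (size (s y))%:R); first by rewrite ler_nat.
rewrite -ler_pdivrMr// mulrC; apply: le_eta => i.
have -> : (N%:R^-1 *: abel R (s y)) i 0 + (N%:R^-1 *: abel R (s z)) i 0 =
    N%:R^-1 * abel R (s v) i 0.
  by rewrite Ew !mxE mulrDr.
rewrite -(ler_pM2l NR) [N%:R * delta]mulrC; apply: le_trans (wf i).
by rewrite -[X in X * `|_|]ger0_norm// -normrM mulrBr mulVKf ?gt_eqF.
Qed.

(** The bound c s comes from blocks of a level that depends only on s. For a given n,
    a long enough word with frequencies close to f has, for each s < n, at most
    a proportion 2^-(s+2) of bad positions, half of the positions altogether; so
    some position is good for all s < n and is followed by n letters. *)
Lemma extreme_words (f : 'cV[R]_#|A 0%N|) (h : nat -> 'I_#|A 0%N| -> R) :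
  extreme_point (lsimplex sigma) f -> (forall s, dot (h s) f < 0) ->
  exists c : nat -> R, forall n, exists x : seq (A 0%N), [/\ size x = n,
    forall m, (m <= n)%N -> factorial_closure (range (@subst_prefix A sigma m)) x &
    forall s l, (s < n)%N -> \sum_(a <- take l x) h s (enum_rank a) <= c s].
Proof.
move=> extf hf.
have /choice[mdc mdcP] : forall s, exists mdc : nat * R * R, 0 < mdc.1.2 /\
    forall w (N : nat), range (@subst_prefix A sigma mdc.1.1.+1) w -> (0 < N)%N ->
    (forall i, `|abel R w i 0 - N%:R * f i 0| <= mdc.1.2 * N%:R) ->
    (overshoot_count (fun a => h s (enum_rank a)) mdc.2 w)%:R
      <= 2^-1 ^+ s.+2 * N%:R :> R.
  move=> s; have eta0 : 0 < 2^-1 ^+ s.+2 :> R by rewrite exprn_gt0.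
  have [m [delta [c mdcP]]] := words_with_few_overshoots extf (hf s) eta0.
  by exists (m, delta, c).
exists (fun s => (mdc s).2) => n.
pose m := maxn n (\max_(s < n) (mdc s).1.1).
have [[Cf tf] _] := extf.
have := Cf m I; rewrite cone_seqE => /image_cone_words[k k0 kP].
pose d : R := #|A 0%N|%:R.
have d0 : 0 <= d by [].
pose K := \sum_(s < n) k / (mdc s).1.2.
have kdelta0 (s : nat) : 0 <= k / (mdc s).1.2.
  by have [delta0 _] := mdcP s; rewrite divr_ge0// ltW.
have K0 : 0 <= K by rewrite sumr_ge0.
have ndk0 : 0 <= n%:R + d * k by rewrite addr_ge0// mulr_ge0.
(* N is approximately the length of the word: the first term of the bound leaves
   room for n letters after a good position, the second makes the rounding error
   k smaller than all the tolerances times N. *)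
pose N := (Num.truncn (2 * (n%:R + d * k) + K)).+1.
have ltN : 2 * (n%:R + d * k) + K < N%:R.
  by have /truncn_itv/andP[] : 0 <= 2 * (n%:R + d * k) + K by lra.
have [v vP] := kP N; set w := prefix_substitution _ _ _ in vP.
have rw : range (@subst_prefix A sigma m.+1) w by exists v.
have few (s : 'I_n) :
    (overshoot_count (fun a => h s (enum_rank a)) (mdc s).2 w)%:R
      <= 2^-1 ^+ s.+2 * N%:R :> R.
  have [delta0 /(_ w N)] := mdcP s; apply=> // [|i].
    apply: subst_prefix_range rw; rewrite ltnS leq_max; apply/orP; right.
    exact: (leq_bigmax s).
  apply: le_trans (vP i) _; rewrite mulrC -ler_pdivrMr//.
  suff : k / (mdc s).1.2 <= K by lra.
  by rewrite /K (bigD1 s)//= lerDl sumr_ge0.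
have le_size : N%:R - d * k <= (size w)%:R.
  have : `|mass (abel R w - N%:R *: f)| <= d * k.
    rewrite massE; apply: le_trans (ler_norm_sum _ _ _) _.
    apply: (@le_trans _ _ (\sum_(i < #|A 0%N|) k)).
      by apply: ler_sum => i _; move: (vP i); rewrite !mxE.
    by rewrite sumr_const card_ord -mulr_natl.
  rewrite -scaleNr dotD dotZ tf mass_abel mulr1 ler_norml => /andP[+ _]; lra.
pose r := iota 0 (size w - n).
pose P (s : nat) p := overshoots (fun a => h s (enum_rank a)) (mdc s).2 (drop p w).
have [|p pr pP] := @exists_avoiding _ r n P.
  rewrite size_iota ltn_subRL -(ltr_nat R) natrD natr_sum.
  suff : \sum_(s < n) (count (P s) r)%:R <= 2^-1 * N%:R :> R by lra.
  apply: le_trans (ler_wpM2r (ler0n _ N) (sum_half n)); rewrite mulr_suml.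
  apply: ler_sum => s _; apply: le_trans (few s); rewrite ler_nat.
  by rewrite /overshoot_count -(subnKC (leq_subr n (size w))) iotaD count_cat leq_addr.
rewrite mem_iota add0n ltn_subRL /= in pr.
have sx : size (take n (drop p w)) = n.
  have pn : (p + n <= size w)%N by rewrite addnC ltnW.
  by rewrite size_takel// size_drop leq_subRL// (leq_trans (leq_addr n p)).
exists (take n (drop p w)); split=> // [m' m'n|s l sn].
  exists w; last first.
    apply/infixP; exists (take p w), (drop n (drop p w)).
    by rewrite catA -catA cat_take_drop cat_take_drop.
  by apply: subst_prefix_range rw; rewrite leqW// (leq_trans m'n)// leq_maxl.
rewrite leNgt; apply/negP => lt_c; have /negP := pP s sn; apply; apply/asboolP.
by exists (minn l n); rewrite take_min.
Qed.

(** For i a letter, b a sign and q an integer, the functional attached to (i, b, q)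
    measures by how much the signed deviation of the count of i from f_i times
    the length exceeds 1/(q+1) times the length. Bounded sums along the prefixes
    for all (i, b, q) mean that all the deviations are o(length). The triples
    are enumerated by their countable type structure. *)
Lemma extreme_frequency (f : 'cV[R]_#|A 0%N|) : extreme_point (lsimplex sigma) f ->
  exists2 u, Sadic_shift sigma u & frequency_vector u f.
Proof.
move=> extf; have [[Cf tf] _] := extf; pose d := #|A 0%N|.
pose test (t : 'I_d * bool * nat) (j : 'I_d) : R :=
  (-1) ^+ t.1.2 * ((j == t.1.1)%:R - f t.1.1 0) - t.2.+1%:R^-1.
have dot_test t (x : 'cV[R]_d) : dot (test t) x =
    (-1) ^+ t.1.2 * (x t.1.1 0 - f t.1.1 0 * mass x) - t.2.+1%:R^-1 * mass x.
  rewrite massE /dot /test.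
  under eq_bigr do rewrite mulrBl -mulrA mulrBl.
  rewrite sumrB -!mulr_sumr sumrB -mulr_sumr; congr (_ * (_ - _) - _).
  by rewrite (bigD1 t.1.1)//= eqxx mul1r big1 ?addr0// => j /negbTE ->; rewrite mul0r.
pose h s : 'I_d -> R := if unpickle s is Some t then test t else fun=> -1.
have hf s : dot (h s) f < 0.
  rewrite /h; case: unpickle => [t|].
    by rewrite dot_test tf !mulr1 subrr mulr0 sub0r oppr_lt0 invr_gt0.
  have -> : dot (fun=> -1) f = - mass f.
    by rewrite /dot -sumrN; apply: eq_bigr => i _; rewrite mulN1r mul1r.
  by rewrite tf oppr_lt0.
have [c /choice[x xP]] := extreme_words extf hf.
have [|u uP] := @prefix_limit _ x; first by move=> n; have [] := xP n.
exists u.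
  move=> k n m _; have [N leN pN] := uP (k + n)%N m.
  have [_ /(_ m leN)[w rw xw] _] := xP N; exists w => //.
  apply: infix_trans (infix_trans (prefixW pN) xw).
  apply/infixP; exists (mkseq u k), [::].
  by rewrite cats0 /mkseq iotaD map_cat.
have bound s k : \sum_(a <- mkseq u k) h s (enum_rank a) <= c s.
  have [N leN pN] := uP k (maxn s.+1 k).
  have [sx _ /(_ s k)] := xP N.
  have -> : take k (x N) = mkseq u k.
    by move: pN; rewrite prefixE size_mkseq => /eqP.
  by apply; apply: leq_trans leN; exact: leq_maxl.
have dev (i : 'I_d) (b : bool) (q k : nat) :
    (-1) ^+ b * ((count_mem (enum_val i) (mkseq u k))%:R - f i 0 * k%:R) <=
    c (pickle (i, b, q)) + q.+1%:R^-1 * k%:R.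
  have := bound (pickle (i, b, q)) k; rewrite -lerBlDr.
  by rewrite -dot_abel /h pickleK dot_test mass_abel size_mkseq /= mxE.
move=> i; apply/cvgrPdist_le => e e0.
have [q qe] : exists q : nat, q.+1%:R^-1 <= e / 2.
  have /filter_ex[q /ltW ?] := @near_infty_natSinv_lt R (PosNum (divr_gt0 e0 (ltr0n _ 2))).
  by exists q.
pose C := `|c (pickle (i, false, q))| + `|c (pickle (i, true, q))|.
have e2 : 0 < e / 2 by rewrite divr_gt0.
apply: filterS2 (near_div_le C e2) (nbhs_infty_gt 0) => k Ck k0.
have kR : 0 < k%:R :> R by rewrite ltr0n.
pose cnt : R := (count_mem (enum_val i) (mkseq u k))%:R; rewrite -/cnt.
have -> : f i 0 - cnt / k%:R = (f i 0 * k%:R - cnt) / k%:R.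
  by rewrite mulrBl mulfK ?gt_eqF.
rewrite normrM [`|_^-1|]gtr0_norm ?invr_gt0// ler_pdivrMr//.
have {}Ck : C <= e / 2 * k%:R by rewrite -ler_pdivrMr.
have qk : q.+1%:R^-1 * k%:R <= e / 2 * k%:R by rewrite ler_wpM2r.
have := dev i false q k; have := dev i true q k.
rewrite expr0 expr1 mul1r mulN1r -/cnt.
move: (q.+1%:R^-1 * k%:R) qk => Q qk d1 d2.
have c1 := ler_norm (c (pickle (i, false, q))).
have c2 := ler_norm (c (pickle (i, true, q))).
have n1 := normr_ge0 (c (pickle (i, false, q))).
have n2 := normr_ge0 (c (pickle (i, true, q))).
rewrite /C in Ck; clearbody cnt; rewrite ler_norml; apply/andP; split; lra.
Qed.

End Construction.

(** * The limit cone is the convex hull *)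

Theorem theorem3p10 (R : realType) (A : nat -> finType)
    (sigma : forall n, substitution (A n.+1) (A n))
    (A_nonempty : forall n, (0 < #|A n|)%N)
    (growing : everywhere_growing sigma) :
  set_lim (cone_seq (R := R) sigma) (\bigcap_n cone_seq (R := R) sigma n) /\
  \bigcap_n cone_seq (R := R) sigma n =
    convex_hull (\bigcup_(f in [set f : 'cV[R]_#|A 0%N| |
                    exists2 u, Sadic_shift sigma u & frequency_vector u f])
                  half_line f).
Proof.
set C := \bigcap_n _; split.
  split; apply/seteqP; split=> x.
  - move=> [m _ xm] n _; apply: (cone_seq_subset (leq_maxr m n)).
    by apply: xm; exact: leq_maxl.
  - by move=> Cx; exists 0%N => // n _; exact: Cx.
  - move=> lx n _; have [m mn xm] := lx n I.
    exact: cone_seq_subset mn _ xm.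
  - by move=> Cx n _; exists n; [exact: leqnn|exact: Cx].
apply/seteqP; split=> [x Cx D [cD FD]|]; last first.
  apply: smallest_sub => [|_ [f [u uX uf] [t t0 <-]]].
    apply/convex_setP => x y t /andP[t0 t1] Cx Cy.
    by apply: lconeD; apply: lconeZ => //; rewrite subr_ge0.
  exact: lconeZ t0 (frequency_in_lcone uX uf).
have cK : @convex_set R 'cV[R]_#|A 0%N| (lsimplex sigma).
  apply/convex_setP => y z t /andP[t0 t1] [Cy ty] [Cz tz]; split.
    by apply: lconeD; apply: lconeZ => //; rewrite subr_ge0.
  by rewrite dotD !dotZ ty tz; ring.
have closedK : limit_closed (@lsimplex R A sigma).
  move=> U X y UU KX Xy; split.
    by apply: (lcone_closed (U := U)) Xy; apply: filterS KX => j [].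
  apply: (cvg_unique _ (dot_cvg UU Xy)); first exact: norm_hausdorff.
  by apply: cvg_near_cst; apply: filterS KX => j [].
have boundK (y : 'cV[R]_#|A 0%N|) : lsimplex sigma y -> forall i, `|y i 0| <= 1.
  move=> [/lcone_orthant y0 <-] i; rewrite ger0_norm//; exact: entry_le_mass.
have hullK D' : @convex_set R 'cV[R]_#|A 0%N| D' ->
    (forall f, extreme_point (lsimplex sigma) f -> D' f) ->
    forall y : 'cV[R]_#|A 0%N|, lsimplex sigma y -> D' y.
  by move=> cD' extD'; exact: (sub_convex_extreme cK closedK boundK cD').
(* D need not be a cone, so it is pulled back by the homothety of ratio r before
   [hullK] is applied. *)
have scale_in (r : R) (y : 'cV[R]_#|A 0%N|) : 0 <= r -> lsimplex sigma y -> D (r *: y).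
  move=> r0; apply: (hullK [set z | D (r *: z)]) => [|f /extreme_frequency ff].
    apply/convex_setP => p q t t01 Dp Dq /=.
    have -> : r *: (t *: p + (1 - t) *: q) = t *: (r *: p) + (1 - t) *: (r *: q).
      by rewrite scalerDr !scalerA (mulrC r t) (mulrC r (1 - t)).
    by move/convex_setP : cD; apply.
  by apply: FD; exists f => //; exists r.
have x0 := lcone_orthant Cx; have [tx|tx] := eqVneq (mass x) 0.
  (* 0 is in the hull only because some half-line exists. *)
  have [y Ky] := lsimplex_nonempty R sigma A_nonempty.
  by rewrite (mass_eq0 x0 tx) -(scale0r y); exact: scale_in.
have -> : x = mass x *: ((mass x)^-1 *: x).
  by rewrite scalerA mulfV// scale1r.
apply: scale_in; first exact: mass_ge0.
by split; [apply: lconeZ => //; rewrite invr_ge0 mass_ge0|rewrite dotZ mulVf].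
Qed.
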